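(* Let $n,k\ge1$ and consider rowmotion $\rho$ acting on $\mathcal{J}({\sf C}_n\times[k])$. For $i\in[n]$ and $a\in[k]$ let $\chi_{(i,a)}$ be the indicator function of the element $(b_i,a)$, i.e. $\chi_{(i,a)}(I)=1$ iff $(b_i,a)\in I$. Then for all $i,j\in[n]$ and $a\in[k]$, the statistic $\chi_{(i,a)}-\chi_{(j,a)}$ is $0$-mesic.
   Context: The claw poset ${\sf C}_n=\{b_1,\dots,b_n,\widehat0\}$ has relations $\widehat0<b_i$ for all $i$ and no others. ${\sf C}_n\times[k]$ carries the product order. $\mathcal{J}(P)$ is the set of order ideals of $P$; rowmotion $\rho$ sends an order ideal $I$ to the order ideal generated by the minimal elements of $P\setminus I$. A statistic is $c$-mesic under $\rho$ if its average over every $\rho$-orbit equals $c$. *)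

(* Defs.v *)
From HB Require Import structures.
From mathcomp Require Import all_boot all_order all_algebra.

Set Implicit Arguments.
Unset Strict Implicit.
Unset Printing Implicit Defensive.

Import Order.TTheory GRing.Theory Num.Theory.

Fact claw_display : Order.disp_t. Proof. exact: (Order.Disp tt tt). Qed.

(* [None] is the bottom element \hat 0 and [Some i] is b_i; [option] carries
   no order of its own in the library. *)
Definition claw (n : nat) : Type := option 'I_n.

HB.instance Definition _ n := Finite.on (claw n).

Section ClawOrder.
Variable n : nat.

Definition claw_hat0 : claw n := None.
Definition claw_b (i : 'I_n) : claw n := Some i.

Definition claw_le (x y : claw n) : bool := (x == claw_hat0) || (x == y).

Fact claw_le_refl : reflexive claw_le.
Proof. by move=> x; rewrite /claw_le eqxx orbT. Qed.

Fact claw_le_anti : antisymmetric claw_le.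
Proof.
move=> x y /andP[/orP[/eqP->|/eqP//] /orP[/eqP->//|/eqP//]].
Qed.

Fact claw_le_trans : transitive claw_le.
Proof.
move=> y x z /orP[/eqP->|/eqP->//] _; by rewrite /claw_le eqxx.
Qed.

HB.instance Definition _ :=
  Order.Le_isPOrder.Build claw_display (claw n)
    claw_le_refl claw_le_anti claw_le_trans.

End ClawOrder.

Section Rowmotion.
Context {d : Order.disp_t} {P : finPOrderType d}.
Implicit Types (A : {set P}) (x y : P).

Definition is_order_ideal A : bool :=
  [forall x, forall y in A, (x <= y)%O ==> (x \in A)].

Definition minimal_elements A : {set P} :=
  [set x in A | [forall y in A, ~~ (y < x)%O]].

Definition generated_ideal A : {set P} :=
  [set x | [exists y in A, (x <= y)%O]].

Record order_ideals : predArgType :=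
  OrderIdeal { ideal_set :> {set P}; _ : is_order_ideal ideal_set }.

HB.instance Definition _ := [isSub for ideal_set].
HB.instance Definition _ := [Finite of order_ideals by <:].

Implicit Types I : order_ideals.

Lemma generated_idealP A : is_order_ideal (generated_ideal A).
Proof.
apply/forallP=> x; apply/forall_inP=> y; rewrite !inE => /exists_inP[z zA yz].
by apply/implyP=> xy; apply/exists_inP; exists z; rewrite // (le_trans xy).
Qed.

Definition rowmotion I : order_ideals :=
  OrderIdeal (generated_idealP (minimal_elements (~: I))).

Lemma minimal_below A x :
  x \in A -> exists2 m, m \in minimal_elements A & (m <= x)%O.
Proof.
move=> xA.
pose Q := [pred y | (y \in A) && (y <= x)%O].
have Qx : Q x by rewrite /= xA lexx.
case: (arg_minnP (fun y => #|[set z | (z <= y)%O]|) Qx) => m /andP[mA mx] min_m.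
exists m => //; rewrite inE mA; apply/forall_inP=> y yA; apply/negP=> ym.
have := min_m y; rewrite /= yA (le_trans (ltW ym) mx) => /(_ isT).
rewrite leqNgt => /negP; apply; apply: proper_card; apply/properP; split.
  by apply/subsetP=> z; rewrite !inE => /le_trans; apply; apply: ltW.
by exists m; rewrite !inE ?lexx // lt_geF.
Qed.

(* Hence the forward orbits used in [mesic] below are the orbits of the
   action of rowmotion as a permutation. *)
Lemma rowmotion_inj : injective rowmotion.
Proof.
have sub I1 I2 : rowmotion I1 = rowmotion I2 -> {subset I2 <= I1}.
  move=> /(congr1 ideal_set)/= eqK x xI2; apply/negPn/negP=> xI1.
  have [|m mM mx] := @minimal_below (~: I1) x; first by rewrite inE.
  have : m \in generated_ideal (minimal_elements (~: I1)).
    by rewrite inE; apply/exists_inP; exists m.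
  rewrite eqK inE => /exists_inP[m2 m2M mm2].
  have : m2 \in generated_ideal (minimal_elements (~: I2)).
    by rewrite inE; apply/exists_inP; exists m2.
  rewrite -eqK inE => /exists_inP[m1 m1M m2m1].
  have m_notlt : ~~ (m < m1)%O.
    move: m1M; rewrite inE => /andP[_ /forall_inP]; apply.
    by move: mM; rewrite inE => /andP[].
  have em : m = m1.
    apply/eqP; move: m_notlt.
    by rewrite lt_neqAle (le_trans mm2 m2m1) andbT negbK.
  have em2 : m = m2 by apply/le_anti; rewrite mm2 em m2m1.
  move: m2M; rewrite -em2 !inE => /andP[/negP mI2 _]; apply: mI2.
  case: I2 xI2 {eqK} => I2 idI2 /= xI2.
  by move/forallP: idI2 => /(_ m)/forall_inP/(_ x xI2)/implyP; apply.
by move=> I1 I2 e; apply/val_inj/setP=> x; apply/idP/idP; apply: sub.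
Qed.

Definition indicator (x : P) (I : order_ideals) : rat := (x \in ideal_set I)%:R.

End Rowmotion.

Arguments order_ideals {d} P.
Arguments rowmotion {d} P I.

Definition mesic (T : finType) (f : T -> T) (stat : T -> rat) (c : rat) : Prop :=
  forall x : T,
    ((\sum_(y <- orbit f x) stat y) / (size (orbit f x))%:R = c)%R.

Definition chi (n k : nat) (i : 'I_n) (a : 'I_k)
    (I : order_ideals (claw n *p 'I_k)%type) : rat :=
  indicator ((claw_b i, a) : (claw n *p 'I_k)%type) I.

(* Main.v *)
(* An order ideal is encoded by the height h of its fibre over \hat 0 and the
   heights x_l <= h of its fibres over the b_l.  Rowmotion sends x_l to x_l + 1
   if x_l < h and resets it to 0 if x_l = h; it sends h to h + 1 if h < k and to
   the maximum of the new x_l if h = k.  Hence the resets run through the values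
   x_l in cyclic order.  If b_j is reset at height m, the next reset happens
   k + 1 - m steps later, exactly k + 2 steps after the previous reset of b_j,
   and hits the next lower value x_i.  Therefore rowmotion^(k+2) replaces x_i by
   its cyclic successor x_j among the values, and x_i and x_j have the same
   distribution on each orbit. *)

Require Import Defs.
From mathcomp Require Import all_boot all_order all_algebra.
From mathcomp Require Import zify.

Set Implicit Arguments.
Unset Strict Implicit.
Unset Printing Implicit Defensive.

Import Order.TTheory GRing.Theory Num.Theory.

(** Injectivity makes [iter m f] permute each orbit, so it only reorders the sum. *)
Lemma iter_orbit_sum (T : finType) (f : T -> T) (F : T -> rat) (m : nat) (x : T) :
  injective f ->
  (\sum_(y <- orbit f x) F (iter m f y) = \sum_(y <- orbit f x) F y)%R.
Proof.
move=> f_inj; rewrite -[LHS](big_map (iter m f) xpredT F).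
apply: perm_big.
have uq : uniq (map (iter m f) (orbit f x)).
  by rewrite map_inj_uniq ?orbit_uniq //; elim: m => //= m IH y z /f_inj/IH.
apply: uniq_perm; rewrite ?orbit_uniq //.
apply: (uniq_min_size uq _ _).2; last by rewrite size_map.
move=> _ /mapP[y yx ->]; rewrite -fconnect_orbit.
by rewrite (connect_trans _ (fconnect_iter f m y)) // fconnect_orbit.
Qed.

Section Claw.
Variables n k : nat.

Notation clawk := (claw n *p 'I_k)%type.
Notation rho := (rowmotion clawk).
Implicit Types (I : order_ideals clawk) (i j l : 'I_n).

(** * Encoding of an ideal by its fibre heights *)

Definition fibre (c : claw n) I : nat :=
  #|[set a : 'I_k | ((c, a) : clawk) \in ideal_set I]|.

Notation h := (fibre None).
Notation X l := (fibre (Some l)).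

Lemma clawk_leE (c c' : claw n) (a a' : 'I_k) :
  (((c, a) : clawk) <= ((c', a') : clawk))%O
    = ((c == None) || (c == c')) && (a <= a').
Proof. by []. Qed.

Lemma idealP I (x y : clawk) : y \in ideal_set I -> (x <= y)%O -> x \in ideal_set I.
Proof.
case: I => A /= /forallP/(_ x)/forall_inP/(_ y) id yA xy.
by move/implyP: (id yA); apply.
Qed.

Lemma card_ord_lt (v : nat) : v <= k -> #|[set a : 'I_k | a < v]| = v.
Proof.
have inj (vk : v <= k) : injective (widen_ord vk).
  by move=> a b /(congr1 val) /= /val_inj.
move=> vk; rewrite -[RHS]card_ord -(card_imset _ (inj vk)).
apply: eq_card => a; rewrite inE; apply/idP/imsetP => [av|[b _ ->]] /=.
  by exists (Ordinal av) => //; apply: val_inj.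
by [].
Qed.

Lemma fibre_le c I : fibre c I <= k.
Proof. by rewrite -[Z in _ <= Z]card_ord max_card. Qed.

(** The fibre is a down-closed subset of a chain, hence an initial segment, so its cardinality
    decides membership. *)
Lemma in_fibre c I (a : 'I_k) : (((c, a) : clawk) \in ideal_set I) = (a < fibre c I).
Proof.
set F := [set a : 'I_k | ((c, a) : clawk) \in ideal_set I].
have down (b b' : 'I_k) : b' \in F -> b <= b' -> b \in F.
  by rewrite !inE => b'I bb'; apply: idealP b'I _; rewrite clawk_leE eqxx orbT.
have -> : (((c, a) : clawk) \in ideal_set I) = (a \in F) by rewrite inE.
rewrite /fibre -/F.
apply/idP/idP => [aF|].
  rewrite -[Z in Z <= _](@card_ord_lt a.+1) //.
  by apply/subset_leq_card/subsetP => b; rewrite inE ltnS; apply: down.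
apply: contraLR => aF; rewrite -leqNgt -[Z in _ <= Z](@card_ord_lt a); last exact: ltnW.
apply/subset_leq_card/subsetP => b bF; rewrite inE ltnNge.
by apply: contra aF; apply: down.
Qed.

Lemma fibre_eq c I v : v <= k ->
  (forall a : 'I_k, (((c, a) : clawk) \in ideal_set I) = (a < v)) -> fibre c I = v.
Proof.
by move=> vk E; rewrite -[RHS]card_ord_lt //; apply: eq_card => a; rewrite !inE.
Qed.

Lemma fibre_le_hat0 l I : X l I <= h I.
Proof.
apply/subset_leq_card/subsetP => a; rewrite !inE => aI.
by apply: idealP aI _; rewrite clawk_leE eqxx /=.
Qed.

(** * Rowmotion on fibre heights *)

Lemma minimal_hat0 I (b : 'I_k) :
  (((None, b) : clawk) \in minimal_elements (~: ideal_set I)) = (b == h I :> nat).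
Proof.
rewrite !inE in_fibre -leqNgt; apply/andP/eqP => [[hb /forall_inP m]|bh].
  apply/eqP; rewrite eqn_leq hb andbT leqNgt; apply/negP => hlt.
  have hk : h I < k by apply: leq_ltn_trans hb _.
  have := m ((None, Ordinal hk) : clawk); rewrite inE in_fibre /= ltnn => /(_ isT).
  by rewrite lt_neqAle clawk_leE /= hb andbT negbK => /eqP[] /(congr1 val) /= e; lia.
split; first by rewrite bh.
apply/forall_inP => -[c a]; rewrite inE lt_neqAle clawk_leE; case: c => [l|] //=.
rewrite in_fibre => a1; apply/andP => -[/eqP ne a2]; apply: ne.
by congr pair; apply: val_inj => /=; lia.
Qed.

Lemma minimal_b I l (b : 'I_k) :
  (((Some l, b) : clawk) \in minimal_elements (~: ideal_set I))
    = (b == X l I :> nat) && (b < h I).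
Proof.
rewrite !inE in_fibre -leqNgt; apply/andP/andP => [[hb /forall_inP m]|[/eqP bh lt]].
  split.
    rewrite eqn_leq hb andbT leqNgt; apply/negP => hlt.
    have hk : X l I < k by apply: leq_ltn_trans hb _.
    have := m ((Some l, Ordinal hk) : clawk); rewrite inE in_fibre /= ltnn => /(_ isT).
    move/negP; apply; rewrite lt_neqAle clawk_leE eqxx orbT hb !andbT.
    by apply/eqP => -[e]; rewrite -e ltnn in hlt.
  apply/negPn/negP => nb; have := m ((None, b) : clawk).
  by rewrite inE in_fibre => /(_ nb); rewrite lt_neqAle clawk_leE leqnn.
split; first by rewrite bh.
apply/forall_inP => -[c a]; rewrite inE lt_neqAle clawk_leE in_fibre.
case: c => [l'|] a1; apply/negP => /andP[/eqP ne /andP[]]; last by lia.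
move=> /eqP[e] a2; apply: ne; rewrite e in a1 *.
by congr pair; apply: val_inj => /=; lia.
Qed.

(** Only elements over b_l lie above an element over b_l, so at most one minimal element generates
    the new fibre; there is none when [X l I = h I]. *)
Lemma rowmotion_b l I : X l (rho I) = if X l I < h I then (X l I).+1 else 0.
Proof.
apply: fibre_eq => [|a].
  by case: ifP => // lt; apply: leq_trans lt (fibre_le _ _).
rewrite inE; apply/exists_inP/idP => [[[c b]]|].
  case: c => [l'|]; last by rewrite clawk_leE.
  rewrite minimal_b clawk_leE /= => /andP[/eqP e lt] /andP[/eqP[ell] ab].
  by rewrite -ell in e lt *; rewrite -e lt ltnS.
case: ifP => // lt al; have lk : X l I < k by apply: leq_trans lt (fibre_le _ _).
by exists (Some l, Ordinal lk); rewrite ?minimal_b ?clawk_leE /= ?eqxx.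
Qed.

Lemma rowmotion_hat0_lt I : h I < k -> h (rho I) = (h I).+1.
Proof.
move=> hk; apply: fibre_eq => // a.
rewrite inE; apply/exists_inP/idP => [[[c b]]|al]; last first.
  by exists (None, Ordinal hk); rewrite ?minimal_hat0 ?clawk_leE /=.
case: c => [l'|]; rewrite ?minimal_b ?minimal_hat0 clawk_leE /=; lia.
Qed.

(** With [h I = k] the complement has no element over \hat 0, so the new fibre there is just the
    union of the shadows of the new fibres over the b_l. *)
Lemma rowmotion_hat0_top I i : h I = k ->
  (forall l, X l (rho I) <= X i (rho I)) -> h (rho I) = X i (rho I).
Proof.
move=> hk top; apply: fibre_eq => [|a]; first exact: fibre_le.
apply/idP/idP => [|ai]; last first.
  by rewrite in_fibre (leq_trans ai) ?fibre_le_hat0.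
rewrite inE => /exists_inP[[[l|] b]].
  rewrite minimal_b clawk_leE /= => /andP[/eqP e lt] ab.
  by apply: leq_trans (top l); rewrite rowmotion_b -e lt ltnS.
by rewrite minimal_hat0 hk => /eqP e; have := ltn_ord b; rewrite e ltnn.
Qed.

(** * Cyclic order of the values and timing of the resets *)

(* [j] comes directly after [i] in the cyclic order of the values [X l I]. *)
Definition cyc_next i j I : Prop :=
  (X i I < X j I /\ forall l, ~~ (X i I < X l I < X j I)) \/
  (X j I < X i I /\ forall l, X j I <= X l I <= X i I).

(** Values below [h I] grow by one and the value [h I] wraps around to 0, which rotates the cyclic
    order. The two disjuncts swap exactly when the larger of the two values is reset. *)
Lemma cyc_next_rowmotion i j I : cyc_next i j I -> cyc_next i j (rho I).
Proof.
rewrite /cyc_next !rowmotion_b; move: (fibre_le_hat0 i I) (fibre_le_hat0 j I) => hi hj.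
case=> -[ij H].
  case: (ltnP (X j I) (h I)) => jh; [left | right]; rewrite (_ : X i I < h I);
    try lia; split=> // l; move: (H l) (fibre_le_hat0 l I);
    rewrite rowmotion_b; case: ifP; lia.
case: (ltnP (X i I) (h I)) => ih; [right | left]; rewrite (_ : X j I < h I);
  try lia; split=> // l; move: (H l) (fibre_le_hat0 l I);
  rewrite rowmotion_b; case: ifP; lia.
Qed.

(** The bound is [k.+1], not [k]: the last step may start from height [k] over \hat 0, where the
    b-fibres still lie strictly below and grow once more. *)
Lemma fibre_climb I b : (forall l, X l I < h I) -> h I + b <= k.+1 ->
  forall l, X l (iter b rho I) = X l I + b.
Proof.
elim: b I => [|b IH] I lt hb l; first by rewrite addn0.
have X1 l' : X l' (rho I) = (X l' I).+1 by rewrite rowmotion_b lt.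
case: b IH hb => [|b] IH hb; first by rewrite /= X1 addn1.
have h1 : h (rho I) = (h I).+1 by apply: rowmotion_hat0_lt; lia.
rewrite iterSr IH ?h1; [rewrite X1; lia| |lia].
by move=> l'; rewrite X1 ltnS lt.
Qed.

Lemma hat0_climb I b : h I + b <= k -> h (iter b rho I) = h I + b.
Proof.
elim: b I => [|b IH] I hb; first by rewrite addn0.
have h1 : h (rho I) = (h I).+1 by apply: rowmotion_hat0_lt; lia.
by rewrite iterSr IH h1; lia.
Qed.

(* Once [j] is about to be reset, the next fibre to be reset is that of [i]. *)
Lemma after_reset i j I : cyc_next i j I -> X j I = h I ->
  [/\ forall b, b <= k.+1 - h I -> X i (iter b rho I) = X i I + b,
      X j (iter (k.+1 - h I) rho I) = k - h I &
      h (iter (k.+1 - h I) rho I) = X i I + (k.+1 - h I)].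
Proof.
move=> [[ij H]|[ji H]] jh; last by move: (fibre_le_hat0 i I); lia.
have hk := fibre_le None I.
have le1 l : X l I < h I -> X l I <= X i I by move: (H l); lia.
have top l : X l (rho I) <= X i (rho I).
  by rewrite !rowmotion_b -{2}jh ij; case: ifP => // /le1.
have Xi : X i (rho I) = (X i I).+1 by rewrite rowmotion_b -jh ij.
have Xj : X j (rho I) = 0 by rewrite rowmotion_b jh ltnn.
(* If [h I = k], this very step drops [h] to the highest fibre, that of [i]. Otherwise [h] first
   climbs to [k]. *)
case: (ltnP (h I) k) => hI; last first.
  have -> : k.+1 - h I = 1 by lia.
  split=> [[|[|b]]||] //=; rewrite ?addn0 ?addn1 //; first by lia.
  by rewrite (rowmotion_hat0_top (i := i)) //; lia.
have h1 := rowmotion_hat0_lt hI.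
have lt l : X l (rho I) < h (rho I) by rewrite h1 rowmotion_b; case: ifP; lia.
have -> : k.+1 - h I = (k - h I).+1 by lia.
have clb b l : b <= k - h I -> X l (iter b.+1 rho I) = X l (rho I) + b.
  by move=> bk; rewrite iterSr fibre_climb //; lia.
split=> [[|b] bk||]; first by rewrite addn0.
- by rewrite clb // Xi; lia.
- by rewrite clb // Xj.
(* In [I'] the height over \hat 0 is [k], and the next step drops it to the fibre of [i], still the
   highest because all fibres climbed equally. *)
set I' := iter (k - h I) rho I.
have hI' : h I' = k by rewrite hat0_climb; lia.
rewrite iterS -/I' (rowmotion_hat0_top (i := i)) //.
  by rewrite -iterS clb // Xi; lia.
by move=> l; rewrite -!iterS !clb // leq_add2r top.
Qed.

(** While [j] climbs, each step lowers [k.+1 - X j I] by one; once [X j I = h I], the claim is part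
    of [after_reset]. *)
Lemma no_reset i j I b : cyc_next i j I -> X i I < X j I -> b <= k.+1 - X j I ->
  X i (iter b rho I) = X i I + b.
Proof.
elim: b I => [|b IH] I adj ij hb; first by rewrite addn0.
have := fibre_le_hat0 j I; rewrite leq_eqVlt => /orP[/eqP jh|jh].
  by have [-> //] := after_reset adj jh; rewrite -jh.
have Xi : X i (rho I) = (X i I).+1 by rewrite rowmotion_b (ltn_trans ij jh).
have Xj : X j (rho I) = (X j I).+1 by rewrite rowmotion_b jh.
rewrite iterSr IH ?Xi ?Xj //; [lia|exact: cyc_next_rowmotion|lia].
Qed.

Lemma iter_cyc_next i j I b : cyc_next i j I -> cyc_next i j (iter b rho I).
Proof. by move=> adj; elim: b => //= b; apply: cyc_next_rowmotion. Qed.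

(* Following [j] up to its next reset, it suffices to treat the case where [j]
   is about to be reset. *)
Lemma fibre_shift i j I : cyc_next i j I -> X i (iter k.+2 rho I) = X j I.
Proof.
have [m] := ubnP (k - X j I); elim: m I => // m IH I jm adj.
have := fibre_le_hat0 j I; rewrite leq_eqVlt => /orP[/eqP jh|jh]; last first.
  have Xj : X j (rho I) = (X j I).+1 by rewrite rowmotion_b jh.
  have := IH (rho I); rewrite Xj => /(_ _ (cyc_next_rowmotion adj)).
  (* The height of [i] after [k + 3] steps is [(X j I).+1], hence nonzero, so the last step was no
     reset and can be undone. *)
  rewrite -iterSr iterS rowmotion_b; have := fibre_le None I.
  by case: ifP => _ ? H; have := H ltac:(lia); lia.
have [Hi Hj Hh] := after_reset adj jh; have hk := fibre_le None I.
set I' := iter (k.+1 - h I) rho I in Hi Hj Hh.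
have Xi' : X i I' = h I' by rewrite /I' Hi // Hh.
have adj' : cyc_next i j I' by apply: iter_cyc_next.
have ji : X j I' < X i I' by rewrite Xi' Hh Hj; lia.
have Xi0 : X i (rho I') = 0 by rewrite rowmotion_b Xi' ltnn.
have Xj1 : X j (rho I') = (k - h I).+1 by rewrite rowmotion_b -Xi' ji Hj.
(* The first [k.+1 - h I] steps raise [i] to the top, one step resets it, and the remaining
   [h I = X j I] steps make it climb from 0. *)
have -> : k.+2 = h I + (k.+1 - h I).+1 by lia.
rewrite iterD iterS -/I' (no_reset (j := j)) ?Xi0 ?Xj1 ?jh //.
  exact: cyc_next_rowmotion.
by lia.
Qed.

(** * Comparison of orbit sums *)

Lemma fibre_eq_iter i j I b :
  X i I = X j I -> X i (iter b rho I) = X j (iter b rho I).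
Proof. by move=> e; elim: b => //= b IH; rewrite !rowmotion_b IH. Qed.

Lemma orbit_iter I J : J \in orbit rho I -> exists b, J = iter b rho I.
Proof. by rewrite -fconnect_orbit => /iter_findex <-; exists (findex rho I J). Qed.

Lemma orbit_sum_cyc_next i j I (F : nat -> rat) : cyc_next i j I ->
  (\sum_(J <- orbit rho I) F (X i J) = \sum_(J <- orbit rho I) F (X j J))%R.
Proof.
move=> adj.
rewrite -(iter_orbit_sum (fun J => F (X i J)) k.+2 I (@rowmotion_inj _ _)).
apply: eq_big_seq => J /orbit_iter[b ->].
by rewrite (fibre_shift (j := j)) //; apply: iter_cyc_next.
Qed.

(** Induction on the gap between the two values: an intermediate value splits it, and without one
    [j] follows [i] cyclically. Equal values stay equal along the orbit. *)
Lemma orbit_sum_fibre i j I (F : nat -> rat) :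
  (\sum_(J <- orbit rho I) F (X i J) = \sum_(J <- orbit rho I) F (X j J))%R.
Proof.
wlog ij : i j / X i I <= X j I.
  by move=> W; case: (leqP (X i I) (X j I)) => [/W//|/ltnW/W].
have [m] := ubnP (X j I - X i I); elim: m i j ij => // m IH i j ij lt.
move: ij; rewrite leq_eqVlt => /orP[/eqP e|ij].
  by apply: eq_big_seq => J /orbit_iter[b ->]; rewrite (fibre_eq_iter b e).
case: (pickP (fun l => X i I < X l I < X j I)) => [l /andP[il lj]|none].
  by rewrite (IH i l) ?(IH l j) //; lia.
by apply: orbit_sum_cyc_next; left; split=> // l; rewrite none.
Qed.

End Claw.

Theorem theorem4p12 (n k : nat) (hn : 1 <= n) (hk : 1 <= k)
    (i j : 'I_n) (a : 'I_k) :
  mesic (rowmotion (claw n *p 'I_k)%type)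
    (fun I : order_ideals (claw n *p 'I_k)%type => chi i a I - chi j a I)%R
    0%R.
Proof.
move=> I; rewrite sumrB.
have chiE l J : chi l a J = (a < fibre (Some l) J)%:R%R.
  by rewrite /chi /indicator in_fibre.
under eq_bigr do rewrite chiE; under [Z in (_ - Z)%R]eq_bigr do rewrite chiE.
by rewrite (orbit_sum_fibre i j I (fun v => (a < v)%:R%R)) subrr mul0r.
Qed.
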